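(* Let $v=12t$ where $t\ge 4$. Then there exists a $(v,3,2)$-BIBD $(X,\mathcal{A})$ that has a strong nesting $\phi:\mathcal{A}\to Y$, $X\subseteq Y$, with $|Y|=w=18t$, and this is optimal: no strong nesting of a $(v,3,2)$-BIBD uses fewer points.
   Context: A $(v,k,\lambda)$-BIBD is a pair $(X,\mathcal{A})$ where $X$ is a set of $v$ points and $\mathcal{A}$ is a multiset of $k$-subsets of $X$ (blocks) such that every pair of distinct points lies in exactly $\lambda$ blocks. Given a $(v,k,\lambda)$-BIBD $(X,\mathcal{A})$ and a set $Y\supseteq X$ with $|Y|=w$, a map $\phi:\mathcal{A}\to Y$ is a strong nesting if (1) $\phi(A)\notin A$ for every block $A\in\mathcal{A}$, and (2) the multiset of pairs $\{\{x,\phi(A)\}: A\in\mathcal{A},\ x\in A\}$ (one pair for each block $A$, counted with multiplicity in $\mathcal{A}$, and each $x\in A$) consists of distinct pairs. A strong nesting is optimal if $w=|Y|$ is as small as possible. *)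

(* Defs.v *)
From mathcomp Require Import all_boot.
Set Implicit Arguments. Unset Strict Implicit. Unset Printing Implicit Defensive.

(* Points of the design: 'I_v.  Blocks: a sequence (= multiset, repetitions
   allowed) of subsets of 'I_v. *)
Definition is_bibd (v k lam : nat) (B : seq {set 'I_v}) : Prop :=
  (forall A, A \in B -> #|A| = k) /\
  (forall x y : 'I_v, x != y -> count (fun A : {set 'I_v} => (x \in A) && (y \in A)) B = lam).

Definition blk v (B : seq {set 'I_v}) (i : 'I_(size B)) : {set 'I_v} :=
  tnth (in_tuple B) i.

(* Y ⊇ X is modelled by an injection emb : 'I_v -> 'I_w; phi maps each block
   (by its index in the multiset) to a point of Y. *)
Definition strong_nesting v w (B : seq {set 'I_v}) (emb : 'I_v -> 'I_w)
    (phi : 'I_(size B) -> 'I_w) : Prop :=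
  (forall i, phi i \notin emb @: blk i) /\
  (forall (i j : 'I_(size B)) (x y : 'I_v),
     x \in blk i -> y \in blk j ->
     [set emb x; phi i] = [set emb y; phi j] -> i = j /\ x = y).

Definition has_strong_nesting (v k lam w : nat) : Prop :=
  exists (B : seq {set 'I_v}) (emb : 'I_v -> 'I_w) (phi : 'I_(size B) -> 'I_w),
    injective emb /\ is_bibd k lam B /\ strong_nesting emb phi.

(* Main.v *)
(** Call a frame on t groups a family of triples with centers over X = T x 12
    and Y = T x 18 in which every pair of X from different groups lies in exactly
    two triples, no other pair is covered, and the pairs {x, center} are pairwise
    distinct and never inside a group.  Filling every group of a frame with a
    strongly nested (12,3,2)-BIBD on 18 points gives the design.  Frames are
    closed under pairwise balanced designs (Wilson): replace each block of size k
    by a frame on k groups.  For t >= 28 one can write t = 4m + u1 + u2 + u3 with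
    m coprime to 30 and u_i <= m different from 2 and 3, so truncating three groups
    of a transversal design TD(7,m) gives blocks of sizes 4, ..., 7 and groups of
    sizes m, u_i, and induction applies; for 4 <= t <= 27 there are frames
    invariant under Z_12t.  For optimality, a strong nesting uses v(v-1)
    distinct pairs {x, center}, each of which meets X. *)
Require Import Defs.
From mathcomp Require Import all_boot.
From mathcomp Require Import zify.
Set Implicit Arguments. Unset Strict Implicit. Unset Printing Implicit Defensive.

(** * Families of triples with centers, described by pair counts *)

Section Nested.
Variable Y : eqType.
Implicit Types (X : pred Y) (E : Y -> Y -> nat) (F : seq (Y * Y * Y * Y)).

(** Each unordered pair is listed in both orders, so multiplicities of unordered pairs become
    symmetric counts of ordered ones. *)
Definition tri (q : Y * Y * Y * Y) :=
  let: (a, b, c, _) := q in [:: (a, b); (b, a); (a, c); (c, a); (b, c); (c, b)].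

Definition star (q : Y * Y * Y * Y) :=
  let: (a, b, c, p) := q in [:: (a, p); (p, a); (b, p); (p, b); (c, p); (p, c)].

(* E counts how often a pair may be used as {x, center}; twice as often it must
   be covered by triples, provided that it lies in X. *)
Definition nested X E F := forall x y,
  count_mem (x, y) (flatten (map tri F)) = 2 * (E x y * (X x && X y)) /\
  count_mem (x, y) (flatten (map star F)) <= E x y.

Definition nestable X E := exists F, nested X E F.

Lemma nestable_ext X E E' : E =2 E' -> nestable X E -> nestable X E'.
Proof. by move=> eqE [F nF]; exists F => x y; rewrite -eqE; apply: nF. Qed.

Lemma nestable0 X : nestable X (fun _ _ => 0).
Proof. by exists [::]. Qed.

(** Concatenating families adds the counts, which preserves both the equality for triples and the
    bound for centers. *)
Lemma nestableD X E1 E2 :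
  nestable X E1 -> nestable X E2 -> nestable X (fun x y => E1 x y + E2 x y).
Proof.
move=> [F1 nF1] [F2 nF2]; exists (F1 ++ F2) => x y.
have [[t1 s1] [t2 s2]] := (nF1 x y, nF2 x y).
by rewrite !map_cat !flatten_cat !count_cat t1 t2 leq_add // mulnDl mulnDr.
Qed.

Lemma nestable_sum (I : eqType) (r : seq I) X (E : I -> Y -> Y -> nat) :
    (forall i, i \in r -> nestable X (E i)) ->
  nestable X (fun x y => \sum_(i <- r) E i x y).
Proof.
elim: r => [|i r IHr] nE.
  by apply: nestable_ext (nestable0 X) => x y; rewrite big_nil.
apply: nestable_ext (nestableD (nE i (mem_head _ _)) (IHr _)) => [x y|j rj].
  by rewrite big_cons.
by apply: nE; rewrite inE rj orbT.
Qed.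

End Nested.

(** Relabelling of points. The maps [f] and [g] are inverse only between [D] and [D'], because the
    points of a design fill just a part of the type of labels. *)
Lemma nestable_map (Y Y' : eqType) (f : Y -> Y') (g : Y' -> Y)
    (D : pred Y) (D' : pred Y') X X' (E : Y -> Y -> nat) (E' : Y' -> Y' -> nat) :
    (forall x y, 0 < E x y -> D x && D y) ->
    (forall x, D x -> [/\ D' (f x), g (f x) = x & X' (f x) = X x]) ->
    (forall x, D' x -> D (g x) /\ f (g x) = x) ->
    (forall x y, E' x y = (D' x && D' y) * E (g x) (g y)) ->
  nestable X E -> nestable X' E'.
Proof.
move=> DE fP gP E'P [F nF].
pose f2 (xy : Y * Y) := (f xy.1, f xy.2).
pose f4 (q : Y * Y * Y * Y) := let: (a, b, c, p) := q in (f a, f b, f c, f p).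
have count_f2 x y (s : seq (Y * Y)) : (forall ab, ab \in s -> D ab.1 && D ab.2) ->
    count_mem (x, y) (map f2 s) = (D' x && D' y) * count_mem (g x, g y) s.
  move=> sD; rewrite count_map.
  have [/andP[Dx Dy]|nD] := boolP (D' x && D' y).
    rewrite mul1n; apply: eq_in_count => -[a b] /sD /= /andP[Da Db].
    have [[_ fx] [_ fy]] := (gP _ Dx, gP _ Dy).
    have [[_ ga _] [_ gb _]] := (fP _ Da, fP _ Db).
    rewrite /f2 /= !xpair_eqE; congr (_ && _).
      by apply/eqP/eqP => [<-|->].
    by apply/eqP/eqP => [<-|->].
  rewrite mul0n; apply/eqP; rewrite -leqn0 leqNgt -has_count.
  apply/hasPn => -[a b] /sD /= /andP[Da Db].
  apply: contra nD => /eqP[<- <-].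
  by have [[-> _ _] [-> _ _]] := (fP _ Da, fP _ Db).
have mapT : map (@tri _) (map f4 F) = map (map f2) (map (@tri _) F).
  by rewrite -!map_comp; apply: eq_map => -[[[a b] c] p].
have mapS : map (@star _) (map f4 F) = map (map f2) (map (@star _) F).
  by rewrite -!map_comp; apply: eq_map => -[[[a b] c] p].
(* A pair that occurs has a positive count, hence a positive [E], so it lies in [D]; [k] is 1 for
   centers and 2 for triples. *)
have memE (s : seq (Y * Y)) (k : nat) : (forall x y, count_mem (x, y) s <= k * E x y) ->
    forall ab, ab \in s -> D ab.1 && D ab.2.
  move=> sE [a b] sab; apply: DE; rewrite -has_pred1 has_count in sab.
  by have := leq_trans sab (sE a b); rewrite muln_gt0 => /andP[].
exists (map f4 F) => x y; rewrite mapT mapS -!map_flatten !count_f2.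
- have [-> le_s] := nF (g x) (g y); rewrite E'P.
  split; last by rewrite leq_mul2l le_s orbT.
  case: (boolP (D' x && D' y)) => [/andP[Dx Dy]|_]; last by rewrite !mul0n.
  have [[Dgx fx] [Dgy fy]] := (gP _ Dx, gP _ Dy).
  have [[_ _ X1] [_ _ X2]] := (fP _ Dgx, fP _ Dgy).
  by rewrite !mul1n -X1 -X2 fx fy.
- by apply: (memE _ 1) => a b; have [_] := nF a b; rewrite mul1n.
- apply: (memE _ 2) => a b; have [-> _] := nF a b.
  by case: (X a && X b); rewrite ?muln1 ?muln0.
Qed.

(** * Frames, and Wilson's construction from pairwise balanced designs *)

(* The point (u, i) lies in group u; it belongs to X when i < 12 and is a new
   point when 12 <= i < 18. *)
Definition frame_rel (T : eqType) (s : seq T) (x y : T * nat) : nat :=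
  [&& x.1 \in s, y.1 \in s, x.1 != y.1, x.2 < 18 & y.2 < 18].

Definition frame (T : eqType) (s : seq T) :=
  nestable (fun x : T * nat => x.2 < 12) (frame_rel s).

(** No pair crosses between groups, so the empty family works. This is what allows truncated groups
    of size 0 or 1. *)
Lemma frame_small (T : eqType) (s : seq T) : size s <= 1 -> frame s.
Proof.
case: s => [|u [|]] //= _; apply: nestable_ext (nestable0 _) => -[x i] [y j];
  rewrite /frame_rel //= !inE.
by case: (x =P u) => // ->; case: (y =P u) => // ->; rewrite eqxx.
Qed.

(** Only the number of groups matters: a group is renamed according to its position in the list. *)
Lemma frame_transport (T T' : eqType) (s : seq T) (s' : seq T') :
  uniq s -> uniq s' -> size s = size s' -> frame s -> frame s'.
Proof.
move=> us us' szs; have [|gt1] := leqP (size s') 1.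
  by move=> *; apply: frame_small.
(* With at least two groups both types are inhabited, which supplies the defaults for [nth]. *)
have x0' : T' by case: s' gt1 {us' szs}.
have x0 : T by case: s us szs gt1 => //= _ <-.
pose f (x : T * nat) := (nth x0' s' (index x.1 s), x.2).
pose g (x : T' * nat) := (nth x0 s (index x.1 s'), x.2).
apply: (nestable_map (f := f) (g := g) (D := fun x => x.1 \in s)
                     (D' := fun x => x.1 \in s')).
- by move=> x y; rewrite /frame_rel; case: (x.1 \in s); case: (y.1 \in s).
- move=> [x i] /= sx; have ltx: index x s < size s' by rewrite -szs index_mem.
  by split=> //; rewrite /f /g /= ?mem_nth // index_uniq // nth_index.
- move=> [x i] /= sx; have ltx: index x s' < size s by rewrite szs index_mem.
  by split; rewrite /f /g /= ?mem_nth // index_uniq // nth_index.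
move=> [x i] [y j]; rewrite /frame_rel /g /=.
case sx: (x \in s') => //; case sy: (y \in s') => //; rewrite mul1n /=.
have [ltx lty]: index x s' < size s /\ index y s' < size s by rewrite szs !index_mem.
rewrite !mem_nth // nth_uniq //=; congr (nat_of_bool (~~ _ && _)).
by apply/eqP/eqP => [->//|/(congr1 (nth x0' s'))]; rewrite !nth_index.
Qed.

(** The frame relations of the blocks add up to that of [s]: two points in different groups are
    counted by the unique block through both groups, and two points of one group by none. *)
Lemma frame_pbd (T : eqType) (s : seq T) (B : seq (seq T)) :
    (forall b, b \in B -> {subset b <= s}) ->
    (forall b, b \in B -> frame b) ->
    {in s &, forall x y, x != y -> count (fun b => (x \in b) && (y \in b)) B = 1} ->
  frame s.
Proof.
move=> sB fB cB; apply: nestable_ext (nestable_sum fB) => x y.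
rewrite /frame_rel.
case: (boolP [&& x.1 != y.1, x.2 < 18 & y.2 < 18]) => [/and3P[nxy _ _]|_]; last first.
  by rewrite big1 => [|b _]; rewrite !andbF.
rewrite !andbT; under eq_bigr do rewrite andbT.
case: (boolP ((x.1 \in s) && (y.1 \in s))) => [/andP[sx sy]|ns].
  rewrite -[RHS]/1 -(cB _ _ sx sy nxy) -sum1_count [RHS]big_mkcond /=.
  by apply: eq_bigr => b _; case: (_ && _).
rewrite big1_seq // => b /= Bb.
apply/eqP; rewrite eqb0; apply: contra ns => /andP[bx by_].
by rewrite !(sB b).
Qed.

(** * Truncated transversal designs from lines over Z_m *)

Section TransversalDesign.
Variables (m : nat) (sz : nat -> nat).
Hypothesis sz_full : forall i, i < 4 -> sz i = m.
Hypothesis sz_le : forall i, sz i <= m.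
Hypothesis coprime_m : coprime m 30.

(* Group 6 is the group at infinity: a line of slope b meets it in b. *)
Definition td_coord i a b := if i == 6 then b else (a + i * b) %% m.

Definition td_points := [seq (i, a) | i <- iota 0 7, a <- iota 0 (sz i)].

Definition td_group i := [seq (i, a) | a <- iota 0 (sz i)].

(** The line y = a + b i, without its points in the deleted parts of the truncated groups. *)
Definition td_line a b :=
  [seq (i, td_coord i a b) | i <- [seq i <- iota 0 7 | td_coord i a b < sz i]].

(** Taking the groups as blocks as well makes this a pairwise balanced design: groups cover the
    pairs inside a group, lines the pairs across. *)
Definition td_blocks := [seq td_group i | i <- iota 0 7] ++
  [seq td_line a b | a <- iota 0 m, b <- iota 0 m].

Lemma mem_td_points i x : ((i, x) \in td_points) = (i < 7) && (x < sz i).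
Proof.
apply/allpairsPdep/andP => [[j [y [hj hy [-> ->]]]]|[hi hx]].
  by move: hj hy; rewrite !mem_iota.
by exists i, x; rewrite !mem_iota.
Qed.

Lemma mem_td_group j i x : ((i, x) \in td_group j) = (i == j) && (x < sz j).
Proof.
apply/mapP/andP => [[y hy [-> ->]]|[/eqP-> hx]].
  by move: hy; rewrite mem_iota eqxx.
by exists x; rewrite ?mem_iota.
Qed.

Lemma mem_td_line a b i x :
  ((i, x) \in td_line a b) = [&& i < 7, x < sz i & td_coord i a b == x].
Proof.
apply/mapP/and3P => [[j]|[hi hx /eqP eqx]].
  by rewrite mem_filter mem_iota => /andP[lt_sz hj] [-> ->].
by exists i; rewrite ?mem_filter ?mem_iota ?eqx ?hx.
Qed.

Lemma modn_inj_small a a' : a < m -> a' < m -> a = a' %[mod m] -> a = a'.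
Proof. by move=> lta lta'; rewrite !modn_small. Qed.

(** Differences of indices of the six affine groups have only 2, 3 and 5 as prime factors, so they
    are units modulo [m]. *)
Lemma coprime_diff d : 0 < d < 6 -> coprime m d.
Proof.
move: coprime_m; rewrite (_ : 30 = 2 * 3 * 5) // !coprimeMr => /andP[/andP[c2 c3] c5].
case: d => [|[|[|[|[|[|]]]]]] //= _; first exact: coprimen1.
by rewrite (_ : 4 = 2 * 2) // coprimeMr c2.
Qed.

(** Two points determine their line. If [j] is the group at infinity, it gives the slope directly;
    otherwise subtracting the coordinates leaves (j - i) b, and j - i is a unit. *)
Lemma td_coord_inj i j a b a' b' : i < j < 7 ->
    a < m -> b < m -> a' < m -> b' < m ->
    td_coord i a b = td_coord i a' b' -> td_coord j a b = td_coord j a' b' ->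
  (a, b) = (a', b').
Proof.
move=> /andP[ij j7] ha hb ha' hb'; rewrite /td_coord.
have -> : (i == 6) = false by lia.
move=> eq_i eq_j; suff eqb : b = b'.
  rewrite -eqb in eq_i *; congr (_, _); apply: modn_inj_small => //.
  by apply/eqP; rewrite -(eqn_modDr (i * b)) eq_i.
move: eq_j; case: ifPn => // j6.
have -> : j = i + (j - i) by lia.
have cd : coprime m (j - i) by apply: coprime_diff; lia.
move: (j - i) cd => d cd; rewrite !mulnDl !addnA => eq_j.
have {eq_j} : d * b = d * b' %[mod m].
  apply/eqP; rewrite -(eqn_modDl (a' + i * b')) -eq_j -modnDml -eq_i modnDml.
  exact: eqxx.
(* Ordering the slopes turns the congruence into a divisibility with a genuine subtraction
   [b - b']. *)
wlog le_b : b b' hb hb' {eq_i} / b' <= b => [IH|].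
  case: (leqP b' b) => [|/ltnW] le_b eq_d; first exact: IH.
  by apply/esym; apply: IH.
move/eqP; rewrite eqn_mod_dvd ?leq_mul2l ?le_b ?orbT // -mulnBr Gauss_dvdr //.
rewrite -eqn_mod_dvd // => /eqP; exact: modn_inj_small.
Qed.

Lemma td_coord_lt i a b : b < m -> td_coord i a b < m.
Proof. by rewrite /td_coord; case: ifP => // _ hb; apply: ltn_pmod; lia. Qed.

(** The map from (a, b) to its two coordinates is injective from m^2 pairs to the same m^2 pairs,
    hence bijective, so each value is taken once. *)
Lemma count_td_coord i j x y : i < j < 7 -> x < m -> y < m ->
  count (fun ab => (td_coord i ab.1 ab.2 == x) && (td_coord j ab.1 ab.2 == y))
        [seq (a, b) | a <- iota 0 m, b <- iota 0 m] = 1.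
Proof.
move=> ij hx hy; set P := [seq _ | _ <- _, _ <- _].
pose h ab := (td_coord i ab.1 ab.2, td_coord j ab.1 ab.2).
have memP a b : ((a, b) \in P) = (a < m) && (b < m).
  apply/allpairsP/andP => [[[a' b'] /= [ha hb [-> ->]]]|[ha hb]].
    by move: ha hb; rewrite !mem_iota.
  by exists (a, b); rewrite !mem_iota.
have uP : uniq P by apply: allpairs_uniq; rewrite ?iota_uniq // => -[? ?] [].
have uhP : uniq (map h P).
  rewrite map_inj_in_uniq // => -[a b] [a' b']; rewrite !memP => /andP[ha hb] /andP[ha' hb'].
  by case; apply: td_coord_inj ij _ _ _ _.
have [_ eqP] : (size (map h P) = size P) * (map h P =i P).
  apply: uniq_min_size; rewrite ?size_map // => ab /mapP[[a b]].
  by rewrite memP => /andP[_ hb] ->; rewrite memP !td_coord_lt.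
have := count_uniq_mem (x, y) uhP; rewrite eqP memP hx hy count_map => /= <-.
by apply: eq_count => -[a b] /=; rewrite xpair_eqE.
Qed.

Lemma size_td_points : size td_points = 4 * m + sz 4 + sz 5 + sz 6.
Proof. by rewrite size_allpairs_dep /= !size_iota 4?sz_full //; lia. Qed.

Lemma uniq_td_group i : uniq (td_group i).
Proof. by rewrite map_inj_uniq ?iota_uniq // => x y []. Qed.

Lemma uniq_td_points : uniq td_points.
Proof.
by apply: allpairs_uniq_dep => [|i _|[i x] [j y] _ _ [-> ->]]; rewrite ?iota_uniq.
Qed.

Lemma uniq_td_line a b : uniq (td_line a b).
Proof. by rewrite map_inj_uniq ?filter_uniq ?iota_uniq // => x y []. Qed.

(** A line keeps its points in the four full groups and at most one in each of the other three. *)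
Lemma size_td_line a b : b < m -> 4 <= size (td_line a b) <= 7.
Proof.
move=> hb; rewrite size_map size_filter (iotaD 0 4 3) count_cat.
rewrite (_ : count _ (iota 0 4) = 4).
  by have := count_size (fun i => td_coord i a b < sz i) (iota 4 3); rewrite /=; lia.
by rewrite /= 4?sz_full // !td_coord_lt.
Qed.

(** Wilson's construction applied to the design [td_blocks], whose blocks are lines of size 4 to 7
    and groups of size [sz i]. *)
Lemma frame_td :
    (forall k, 4 <= k <= 7 -> frame (iota 0 k)) ->
    (forall i, i < 7 -> frame (iota 0 (sz i))) ->
  frame (iota 0 (4 * m + sz 4 + sz 5 + sz 6)).
Proof.
move=> frame_k frame_sz.
apply: (@frame_transport _ _ td_points); rewrite ?iota_uniq ?uniq_td_points //.
  by rewrite size_iota size_td_points.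
apply: (@frame_pbd _ _ td_blocks) => [B|B|[i x] [j y]].
- rewrite mem_cat => /orP[/mapP[j]|/allpairsP[[a b] /= [_ _ ->]]] => [|[i x]].
    rewrite mem_iota => hj -> [i x]; rewrite mem_td_group mem_td_points.
    by case/andP=> /eqP-> ->; rewrite andbT.
  by rewrite mem_td_line mem_td_points => /and3P[-> ->].
- rewrite mem_cat => /orP[/mapP[j]|/allpairsP[[a b] /= [_ hb ->]]].
    rewrite mem_iota => hj ->; apply: frame_transport (frame_sz j hj);
      rewrite ?iota_uniq ?uniq_td_group //.
    by rewrite size_map.
  rewrite mem_iota in hb.
  apply: frame_transport (frame_k _ (size_td_line a hb));
    rewrite ?iota_uniq ?uniq_td_line //.
  by rewrite size_iota.
rewrite !mem_td_points => /andP[hi hx] /andP[hj hy] nxy.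
have [ltx lty] := (leq_trans hx (sz_le i), leq_trans hy (sz_le j)).
rewrite count_cat count_map.
(* A pair lies in a common group only when [i = j], and then in that group alone. *)
rewrite (_ : count _ (iota 0 7) = (i == j)); last first.
  rewrite (eq_count (a2 := fun k => (i == j) && pred1 i k)) => [|k /=].
    case: (i == j); last by rewrite count_pred0.
    by rewrite count_uniq_mem ?iota_uniq // mem_iota hi.
  rewrite !mem_td_group; have [->|ne] := eqVneq k i.
    by rewrite hx andbT [i == j]eq_sym; case: eqP => //= <-; rewrite hy.
  by rewrite !andbF.
have allE : [seq td_line a b | a <- iota 0 m, b <- iota 0 m] =
    map (fun ab => td_line ab.1 ab.2) [seq (a, b) | a <- iota 0 m, b <- iota 0 m].
  by rewrite map_allpairs.
rewrite allE count_map.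
have lineE ab : ((i, x) \in td_line ab.1 ab.2) && ((j, y) \in td_line ab.1 ab.2) =
    (td_coord i ab.1 ab.2 == x) && (td_coord j ab.1 ab.2 == y).
  by rewrite !mem_td_line hi hx hj hy.
rewrite (eq_count lineE).
(* A line has at most one point in a group, so it contains no pair inside a group. *)
have [eqij|] := eqVneq i j.
  rewrite (eq_count (a2 := pred0)) ?count_pred0 // => ab /=.
  by apply: contra_neqF nxy => /andP[/eqP<- /eqP<-]; rewrite eqij.
rewrite neq_ltn => /orP[] ltij; rewrite add0n.
  by apply: count_td_coord; rewrite ?ltij.
rewrite (eq_count (fun ab => andbC _ _)).
by apply: count_td_coord; rewrite ?ltij.
Qed.

End TransversalDesign.

(** * Choice of the parameters, and induction on the number of groups *)

(** Consecutive integers coprime to 30 differ by at most 6, as from 1 to 7. Coprimality depends only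
    on k modulo 30, which leaves 30 cases to compute. *)
Lemma coprime30_near k : 5 <= k -> exists2 j, j <= 5 & coprime (k - j) 30.
Proof.
move=> k5; pose r := k %% 30.
have ltr : r < 30 by apply: ltn_pmod.
(* The added 30 keeps the subtraction from truncating when [r < j]. *)
have [j j5 cj] : exists2 j, j <= 5 & coprime (r + 30 - j) 30.
  have /hasP[j] : has (fun j => coprime (r + 30 - j) 30) (iota 0 6).
    move: ltr; rewrite -[r < 30]/(0 <= r < 0 + 30) -mem_iota.
    by move: r; apply/allP; vm_compute.
  by rewrite mem_iota => j6; exists j.
exists j => //; rewrite -coprime_modl; rewrite -coprime_modl in cj.
rewrite (_ : (k - j) %% 30 = (r + 30 - j) %% 30) //; apply/eqP.
rewrite -(eqn_modDr j) !subnK; [|lia|lia].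
by rewrite modnDr modn_mod.
Qed.

Lemma td_parameters t : 28 <= t -> exists m u1 u2 u3,
  [/\ coprime m 30, 7 <= m, t = 4 * m + u1 + u2 + u3 &
      all (fun u => (u <= m) && (u \notin [:: 2; 3])) [:: u1; u2; u3]].
Proof.
move=> t28.
have [m [cm m7 le_t ge_t]] : exists m, [/\ coprime m 30, 7 <= m, 4 * m <= t & t <= 7 * m].
  (* The interval from 4m to 7m reaches 49 for m = 7, and for m = 11 it runs from 44 to 77. Beyond
     77, lowering t / 4 by at most 5 still gives t <= 7m. *)
  case: (leqP t 49) => t49; first by exists 7.
  case: (leqP t 77) => t77; first by exists 11; split=> //; lia.
  have [j j5 cj] := @coprime30_near (t %/ 4) ltac:(lia).
  by exists (t %/ 4 - j); split=> //; lia.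
exists m; have [s es] : exists s, t = 4 * m + s by exists (t - 4 * m); lia.
subst t.
have : s <= 3 * m by lia.
move=> {le_t ge_t t28} les.
suff [u1 [u2 [u3 [-> h]]]] : exists u1 u2 u3, s = u1 + u2 + u3 /\
    all (fun u => (u <= m) && (u \notin [:: 2; 3])) [:: u1; u2; u3].
  by exists u1, u2, u3; split=> //; lia.
(* For s <= 3 use s ones. Otherwise fill the groups greedily; when a remainder 2 or 3 would be left,
   points are moved between the groups so that every part is admissible. Here m >= 7 keeps m - 1, m
   - 2 and 4 admissible. *)
have [s3|s3] := leqP s 3.
  by exists (0 < s), (1 < s), (2 < s); case: s s3 {les} => [|[|[|[|]]]] //=; lia.
have [s1|s1] := leqP s m; first by exists s, 0, 0; rewrite /= !inE; lia.
have [s2|s2] := leqP s (2 * m).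
  have [e|ne] := eqVneq s (m + 2); first by exists m, 1, 1; rewrite /= !inE; lia.
  have [e|ne'] := eqVneq s (m + 3); first by exists (m - 1), 4, 0; rewrite /= !inE; lia.
  by exists m, (s - m), 0; rewrite /= !inE; lia.
have [e|ne] := eqVneq s (2 * m + 2); first by exists m, (m - 2), 4; rewrite /= !inE; lia.
have [e|ne'] := eqVneq s (2 * m + 3); first by exists m, (m - 1), 4; rewrite /= !inE; lia.
by exists m, m, (s - 2 * m); rewrite /= !inE; lia.
Qed.

(** Strong induction: [small] supplies the base cases and the line sizes 4 to 7, while the groups
    are smaller than t and never of size 2 or 3. *)
Lemma frame_iota t : (forall k, 4 <= k < 28 -> frame (iota 0 k)) ->
  t \notin [:: 2; 3] -> frame (iota 0 t).
Proof.
move=> small; elim/ltn_ind: t => t IHt.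
have [t1|t1] := leqP t 1; first by move=> _; apply: frame_small; rewrite size_iota.
rewrite !inE => t23.
have [t27|t28] := ltnP t 28; first by apply: small; lia.
have [m [u1 [u2 [u3 [cm m7 et /and4P[/andP[l1 n1] /andP[l2 n2] /andP[l3 n3] _]]]]]] :=
  td_parameters t28.
(* The default 0 gives size 0 beyond the seven groups, as the bound [sz i <= m] is asked for every
   i. *)
pose sz := nth 0 [:: m; m; m; m; u1; u2; u3].
have -> : t = 4 * m + sz 4 + sz 5 + sz 6 by [].
apply: (@frame_td m sz) => //.
- by case=> [|[|[|[|]]]].
- by case=> [|[|[|[|[|[|[|i]]]]]]] //; rewrite /sz nth_default.
- by move=> k k47; apply: small; lia.
have nm : m \notin [:: 2; 3] by rewrite !inE; lia.
by case=> [|[|[|[|[|[|[|i]]]]]]] //= _; rewrite /sz /=; apply: IHt => //; lia.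
Qed.

(** * Cyclic frames from differences in Z_12t *)

Lemma count_flatten_pairs (T I J : eqType) (p : pred T) (g : I -> J -> seq T)
    (r : seq I) (s : seq J) :
  count p (flatten [seq g i j | i <- r, j <- s]) =
    \sum_(i <- r) \sum_(j <- s) count p (g i j).
Proof. by rewrite count_flatten sumnE big_map big_allpairs_dep. Qed.

Lemma count_flatten_big (T I : Type) (p : pred T) (g : I -> seq T) (r : seq I) :
  count p (flatten (map g r)) = \sum_(i <- r) count p (g i).
Proof. by rewrite count_flatten sumnE !big_map. Qed.

Section CyclicFrame.
Variable t : nat.
Hypothesis t_gt0 : 0 < t.
Let n := 12 * t.
Let h := 6 * t.

Definition shift s a := (a + s) %% n.
(** The element b - a of Z_n, written by cases so that linear arithmetic can treat it. *)
Definition diff a b := if a <= b then b - a else b + n - a.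

(* X is Z_n and the new point n + j stands for the residue j modulo h; point z
   belongs to the group z modulo t.  Since 12t is a multiple of t this labelling
   is uniform for X and the new points. *)
Definition outer_block (q : nat * nat * nat) s :=
  let: (a, b, c) := q in (shift s a, shift s b, shift s c, n + s %% h).
Definition inner_block (q : nat * nat * nat * nat) s :=
  let: (a, b, c, p) := q in (shift s a, shift s b, shift s c, shift s p).

Definition tri_diffs (q : nat * nat * nat) := let: (a, b, c) := q in
  [:: diff a b; diff b a; diff a c; diff c a; diff b c; diff c b].
Definition star_diffs (q : nat * nat * nat * nat) := let: (a, b, c, p) := q in
  [:: diff a p; diff p a; diff b p; diff p b; diff c p; diff p c].
(** Translation by s moves a to a + s and the center to s modulo [h], so point minus center modulo
    [h] is constant: it does for new points what a difference does inside Z_n. *)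
Definition residues (q : nat * nat * nat) := let: (a, b, c) := q in
  [:: a %% h; b %% h; c %% h].

Definition small3 (q : nat * nat * nat) :=
  let: (a, b, c) := q in [&& a < n, b < n & c < n].

Lemma shift_eq s a x : s < n -> a < n -> x < n -> (shift s a == x) = (s == diff a x).
Proof.
move=> hs ha hx; rewrite /shift /diff.
have [lt|ge] := ltnP (a + s) n; first by rewrite modn_small //; case: leqP; lia.
rewrite -{1}(subnK ge) modnDr modn_small; last by lia.
by case: leqP; lia.
Qed.

Lemma diff_lt a b : a < n -> b < n -> diff a b < n.
Proof. by move=> ha hb; rewrite /diff; case: (leqP a b); lia. Qed.

Lemma shift_lt s a : shift s a < n.
Proof. by rewrite ltn_pmod /n //; lia. Qed.

Lemma sum_delta (P : pred nat) d :
  d < n -> \sum_(s <- iota 0 n) ((s == d) && P s) = P d.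
Proof.
move=> hd; rewrite (bigD1_seq d) ?mem_iota ?iota_uniq //= eqxx big1 ?addn0 //.
by move=> s /negbTE->.
Qed.

(** The shift must be x - a and also y - b; these agree exactly when the differences do, and then
    one shift works. *)
Lemma sum_shift a b x y : a < n -> b < n ->
  \sum_(s <- iota 0 n) ((shift s a, shift s b) == (x, y)) =
    ((x < n) && (y < n)) * (diff a b == diff x y).
Proof.
move=> ha hb; case: (boolP (_ && _)) => [/andP[hx hy]|nxy]; last first.
  rewrite big1 // => s _; apply/eqP; rewrite eqb0; apply: contra nxy.
  by case/eqP=> <- <-; rewrite !shift_lt.
have eq_diff : (diff a b == diff x y) = (diff a x == diff b y).
  rewrite /diff; case: (leqP a b); case: (leqP x y); case: (leqP a x);
    case: (leqP b y); lia.
rewrite mul1n eq_diff -[RHS]/(nat_of_bool ((fun s => s == diff b y) (diff a x))).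
rewrite -(sum_delta _ (diff_lt ha hx)); apply: eq_big_seq => s.
by rewrite mem_iota => hs; rewrite xpair_eqE !shift_eq.
Qed.

(** Point [x] minus new point [y - n] modulo [h]; adding [h] prevents truncation. *)
Definition residue_of x y := (x + h - (y - n)) %% h.

Lemma sum_shift_outer a x y : a < n ->
  \sum_(s <- iota 0 n) ((shift s a, n + s %% h) == (x, y)) =
    ((x < n) && (n <= y < n + h)) * (a %% h == residue_of x y).
Proof.
move=> ha; case: (boolP (_ && _)) => [/and3P[hx le_y lt_y]|nxy]; last first.
  rewrite big1 // => s _; apply/eqP; rewrite eqb0; apply: contra nxy.
  case/eqP=> <- <-; rewrite !shift_lt leq_addr ltn_add2l ltn_pmod //.
  by rewrite /h; lia.
rewrite -(subnKC le_y) /residue_of addKn.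
have {le_y lt_y} : y - n < h by lia.
move: (y - n) => {}y hy.
transitivity (\sum_(s <- iota 0 n) ((s == diff a x) && (s %% h == y))).
  apply: eq_big_seq => s; rewrite mem_iota => hs.
  by rewrite xpair_eqE shift_eq // eqn_add2l.
rewrite (sum_delta (fun s => s %% h == y)) ?diff_lt // mul1n.
congr (nat_of_bool _); rewrite -{1}(modn_small hy) -(eqn_modDr a).
have -> : (a %% h == (x + h - y) %% h) = (a + y == x + h %[mod h]).
  by rewrite -(eqn_modDr y) subnK //; lia.
rewrite modnDr eq_sym addnC; congr (_ == _); rewrite /diff.
case: leqP => [le|lt]; first by rewrite subnK.
(* The wraparound adds n = 2h, which vanishes modulo [h]. *)
by rewrite subnK; [rewrite (_ : n = 2 * h) ?modnMDl 1?addnC ?modnMDl // /n /h; lia | lia].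
Qed.

Definition base_tri_diffs (q : nat * nat * nat * nat) :=
  let: (a, b, c, _) := q in tri_diffs (a, b, c).
Definition small4 (q : nat * nat * nat * nat) :=
  let: (a, b, c, p) := q in [&& a < n, b < n, c < n & p < n].

Lemma sum_tri_outer q x y : small3 q ->
  \sum_(s <- iota 0 n) count_mem (x, y) (tri (outer_block q s)) =
    ((x < n) && (y < n)) * count_mem (diff x y) (tri_diffs q).
Proof.
by case: q => [[a b] c] /and3P[ha hb hc] /=; rewrite !big_split /= !sum_shift // big1 // !mulnDr muln0.
Qed.

Lemma sum_tri_inner q x y : small4 q ->
  \sum_(s <- iota 0 n) count_mem (x, y) (tri (inner_block q s)) =
    ((x < n) && (y < n)) * count_mem (diff x y) (base_tri_diffs q).
Proof.
by case: q => [[[a b] c] p] /and4P[ha hb hc hp] /=; rewrite !big_split /= !sum_shift // big1 // !mulnDr muln0.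
Qed.

Lemma sum_star_inner q x y : small4 q ->
  \sum_(s <- iota 0 n) count_mem (x, y) (star (inner_block q s)) =
    ((x < n) && (y < n)) * count_mem (diff x y) (star_diffs q).
Proof.
by case: q => [[[a b] c] p] /and4P[ha hb hc hp] /=; rewrite !big_split /= !sum_shift // big1 // !mulnDr muln0.
Qed.

Lemma sum_star_outer q x y : small3 q ->
  \sum_(s <- iota 0 n) count_mem (x, y) (star (outer_block q s)) =
    ((x < n) && (n <= y < n + h)) * count_mem (residue_of x y) (residues q) +
    ((y < n) && (n <= x < n + h)) * count_mem (residue_of y x) (residues q).
Proof.
have swap a z w s : ((n + s %% h, shift s a) == (z, w)) = ((shift s a, n + s %% h) == (w, z)).
  by rewrite !xpair_eqE andbC.
case: q => [[a b] c] /and3P[ha hb hc] /=; rewrite !big_split /=.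
under [X in _ + (X + _)]eq_bigr do rewrite swap.
under [X in _ + (_ + (_ + (X + _)))]eq_bigr do rewrite swap.
under [X in _ + (_ + (_ + (_ + (_ + (X + _)))))]eq_bigr do rewrite swap.
by rewrite !sum_shift_outer // big1 // !mulnDr !muln0; lia.
Qed.

Variables (O : seq (nat * nat * nat)) (I : seq (nat * nat * nat * nat)).

(** The conditions of a difference family: each nonmultiple of t is a triple difference exactly
    twice, and center differences and residues are distinct nonmultiples of t. Sorting makes them
    quick to evaluate. *)
Definition cyclic_check :=
  let twd := sort leq (flatten (map tri_diffs O) ++ flatten (map base_tri_diffs I)) in
  let sd := sort leq (flatten (map star_diffs I)) in
  let rd := sort leq (flatten (map residues O)) in
  [&& all small3 O, all small4 I,
      twd == flatten [seq [:: d; d] | d <- [seq d <- iota 0 n | d %% t != 0]],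
      sorted ltn sd, all (fun d => d %% t != 0) sd,
      sorted ltn rd & all (fun d => d %% t != 0) rd].


Lemma count_sorted (s : seq nat) d : sorted ltn (sort leq s) ->
  all (fun d => d %% t != 0) (sort leq s) -> count_mem d s <= (d %% t != 0).
Proof.
rewrite ltn_sorted_uniq_leq => /andP[us _] /allP nz.
rewrite -(count_sort leq) count_uniq_mem //.
by case sd: (d \in _) => //; rewrite nz.
Qed.

Definition cyclic_rel x y : nat := [&& x < n + h, y < n + h & x %% t != y %% t].

(** The wraparound [n] is a multiple of t, so it does not change the group. *)
Lemma diff_mod x y : x < n -> y < n -> (diff x y %% t == 0) = (x %% t == y %% t).
Proof.
move=> hx hy; rewrite /diff eq_sym [RHS]eq_sym; case: leqP => [le|lt].
  by rewrite eqn_mod_dvd // eq_sym.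
by rewrite eq_sym -[LHS]/(t %| _) -eqn_mod_dvd ?modnMDr /n ?[12 * t + _]addnC ?[y + _]addnC ?modnMDl //; lia.
Qed.

Lemma residue_of_mod x y : n <= y < n + h ->
  (residue_of x y %% t == 0) = (x %% t == y %% t).
Proof.
move=> /andP[ny yn]; rewrite /residue_of modn_dvdm ?dvdn_mull // -[LHS]/(t %| _).
rewrite -eqn_mod_dvd; last by lia.
rewrite -(eqn_modDr n) subnK // (_ : x + h + n = 18 * t + x) ?modnMDl //.
by rewrite /n /h; lia.
Qed.

(** Summing over all translates turns counts of pairs into counts of differences and residues of the
    base triples, which [cyclic_check] controls. *)
Lemma nested_cyclic : cyclic_check ->
  nested (fun x => x < n) cyclic_rel
    ([seq outer_block q s | q <- O, s <- iota 0 n] ++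
     [seq inner_block q s | q <- I, s <- iota 0 n]).
Proof.
case/and5P=> /allP O_lt /allP I_lt /eqP twd sd_srt /and3P[sd_nz rd_srt rd_nz] x y.
rewrite !map_cat !flatten_cat !count_cat !map_allpairs !count_flatten_pairs.
rewrite (eq_big_seq _ (fun q qO => sum_tri_outer x y (O_lt q qO))).
rewrite (eq_big_seq _ (fun q qI => sum_tri_inner x y (I_lt q qI))).
rewrite (eq_big_seq _ (fun q qO => sum_star_outer x y (O_lt q qO))).
rewrite (eq_big_seq _ (fun q qI => sum_star_inner x y (I_lt q qI))).
rewrite big_split -!big_distrr -!count_flatten_big -mulnDr /=.
have sym : cyclic_rel x y = cyclic_rel y x.
  by rewrite /cyclic_rel eq_sym; do 2!case: (_ < _).
split.
  case: (boolP (_ && _)) => [/andP[hx hy]|_]; last by rewrite muln0.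
  rewrite mul1n muln1 -count_cat -(count_sort leq) twd count_flatten_big big_filter.
  rewrite /cyclic_rel (ltn_addr _ hx) (ltn_addr _ hy) //= -diff_mod //.
  rewrite -big_filter (eq_bigr (fun e => 2 * (e == diff x y))) => [|e _ /=]; last by lia.
  rewrite -big_distrr /=; congr (2 * _).
  transitivity (count_mem (diff x y) [seq d <- iota 0 n | d %% t != 0]).
    by rewrite -sum1_count [RHS]big_mkcond; apply: eq_bigr => e _ /=; case: eqP.
  by rewrite count_uniq_mem ?filter_uniq ?iota_uniq // mem_filter mem_iota /= add0n diff_lt // andbT.
have le_outer a b : [&& a < n, n <= b & b < n + h] *
    count_mem (residue_of a b) (flatten [seq residues i | i <- O]) <=
    [&& a < n, n <= b & b < n + h] * cyclic_rel a b.
  case: (boolP [&& _, _ & _]) => [/and3P[ha nb bn]|_] //.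
  rewrite !mul1n (leq_trans (count_sorted _ rd_srt rd_nz)) //.
  by rewrite residue_of_mod ?nb // /cyclic_rel bn (ltn_addr _ ha).
have le_inner : (x < n) && (y < n) *
    count_mem (diff x y) (flatten [seq star_diffs i | i <- I]) <=
    (x < n) && (y < n) * cyclic_rel x y.
  case: (boolP (_ && _)) => [/andP[hx hy]|_] //.
  rewrite !mul1n (leq_trans (count_sorted _ sd_srt sd_nz)) //.
  by rewrite diff_mod // /cyclic_rel (ltn_addr _ hx) (ltn_addr _ hy).
(* The three indicators are mutually exclusive, according to which of [x], [y] is below [n], so the
   bounds add up to at most [cyclic_rel x y]. *)
have := leq_add (leq_add (le_outer x y) (le_outer y x)) le_inner.
move=> /leq_trans; apply; rewrite -sym -!mulnDl -[leqRHS]mul1n leq_mul2r.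
by apply/orP; right; lia.
Qed.

Lemma frame_cyclic : cyclic_check -> frame (iota 0 t).
Proof.
move=> chk; have nst : nestable (fun x => x < n) cyclic_rel by eexists; apply: nested_cyclic.
(* The quotient by t is below 12 exactly on Z_n and below 18 on all points, since n = 12t and n + h
   = 18t. *)
apply: (nestable_map (f := fun z => (z %% t, z %/ t)) (g := fun x => x.2 * t + x.1)
   (D := fun z => z < n + h) (D' := fun x => (x.1 < t) && (x.2 < 18)) _ _ _ _ nst).
- by move=> x y; rewrite /cyclic_rel; case: (x < _) => //; case: (y < _).
- move=> z hz; rewrite /= ltn_pmod // ltn_divLR // -divn_eq ltn_divLR //.
  by split=> //; move: hz; rewrite /n /h; lia.
- move=> [u l] /= /andP[hu hl]; rewrite modnMDl modn_small // divnMDl // divn_small // addn0.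
  by split=> //; rewrite /n /h; nia.
move=> [u l] [u' l']; rewrite /frame_rel /cyclic_rel !mem_iota /=.
case: (boolP (u < t)) => hu //=; case: (boolP (u' < t)) => hu' //=; last by rewrite andbF.
rewrite !modnMDl !modn_small //.
have E a b : a < t -> (b * t + a < n + h) = (b < 18) by move=> ha; rewrite /n /h; nia.
by rewrite !E //; case: (l < 18); case: (l' < 18); rewrite ?andbF ?andbT //; case: eqP.
Qed.
End CyclicFrame.

(** * Base triples of the cyclic frames for 4 <= t <= 27 *)

(* Entry t - 4 consists of 2(t-1) outer triples, which partition the nonmultiples
   of t in Z_6t when reduced modulo 6t, and 2(t-1) inner triples with centers;
   found by simulated annealing. *)
Definition cyclic_frames : seq (seq (nat * nat * nat) * seq (nat * nat * nat * nat)) := [::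
  ([:: (42,5,43); (17,31,10); (37,15,14); (25,22,47); (33,35,26); (30,27,21)],
   [:: (0,21,2,43); (0,37,42,3); (0,15,34,13); (0,17,35,6); (0,15,5,38); (0,35,18,17)]);
  ([:: (34,13,12); (52,48,11); (3,47,44); (26,23,24); (31,2,8); (51,49,57); (39,28,46); (36,7,29)],
   [:: (0,46,28,32); (0,17,28,6); (0,56,47,39); (0,14,47,16); (0,12,36,13); (0,52,26,19); (0,43,27,9);
     (0,21,12,24)]);
  ([:: (47,21,1); (61,62,27); (41,45,55); (29,44,16); (69,64,56); (68,67,34); (22,2,43); (14,49,35);
     (3,53,46); (40,23,51)],
   [:: (0,69,16,67); (0,9,11,52); (0,56,25,16); (0,50,27,23); (0,55,64,11); (0,47,15,1); (0,5,3,38);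
     (0,23,68,13); (0,65,33,8); (0,19,62,69)]);
  ([:: (48,33,71); (78,82,32); (64,81,61); (47,24,69); (55,18,37); (62,50,38); (4,9,10); (16,3,57);
     (54,44,11); (41,59,25); (23,76,68); (73,43,72)],
   [:: (0,81,6,36); (0,60,58,34); (0,73,9,46); (0,58,68,81); (0,19,44,62); (0,76,40,9); (0,69,32,64);
     (0,27,52,8); (0,82,71,72); (0,67,36,69); (0,5,62,78); (0,4,55,59)]);
  ([:: (5,92,62); (47,27,49); (61,84,11); (83,23,20); (43,30,17); (54,28,29); (19,66,37); (33,45,90);
     (22,2,3); (55,41,34); (60,10,38); (94,79,25); (15,74,69); (39,4,9)],
   [:: (0,41,82,86); (0,6,4,83); (0,67,18,15); (0,33,77,39); (0,52,9,30); (0,12,43,41); (0,17,28,54);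
     (0,58,85,9); (0,90,59,25); (0,62,4,73); (0,81,60,95); (0,86,61,68); (0,62,17,12); (0,89,3,36)]);
  ([:: (66,67,34); (1,48,98); (85,59,21); (38,103,84); (39,25,41); (23,7,78); (82,26,74); (100,89,15);
     (56,37,87); (42,68,19); (22,57,60); (71,51,43); (11,32,4); (106,40,47); (53,83,50); (10,8,70)],
   [:: (0,25,76,33); (0,52,95,58); (0,107,66,38); (0,41,51,10); (0,86,39,83); (0,64,69,104); (0,22,12,96);
     (0,15,29,13); (0,88,4,107); (0,6,74,88); (0,91,79,30); (0,6,83,23); (0,37,13,66); (0,104,87,11);
     (0,93,40,86); (0,103,73,52)]);
  ([:: (18,83,62); (116,102,104); (31,32,114); (34,105,112); (17,49,95); (7,118,66); (96,71,47); (41,68,85);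
     (55,63,59); (22,84,97); (1,57,88); (53,99,46); (12,64,73); (51,87,69); (103,65,81); (93,74,76);
     (29,15,108); (86,19,98)],
   [:: (0,32,3,111); (0,11,54,85); (0,84,55,51); (0,39,5,58); (0,72,37,55); (0,66,19,14); (0,6,115,104);
     (0,62,75,39); (0,26,112,83); (0,23,117,119); (0,114,57,15); (0,31,15,76); (0,87,39,93); (0,28,51,3);
     (0,98,47,34); (0,119,95,7); (0,15,43,92); (0,99,64,26)]);
  ([:: (131,1,68); (82,107,103); (35,38,43); (61,56,21); (10,78,19); (28,58,81); (71,79,89); (48,123,14);
     (24,4,50); (51,20,54); (18,72,108); (105,63,25); (36,92,52); (31,98,27); (126,111,75); (7,100,115);
     (112,29,53); (3,59,40); (96,47,64); (62,83,74)],
   [:: (0,28,97,59); (0,1,31,85); (0,37,50,64); (0,57,16,1); (0,126,47,75); (0,104,131,8); (0,118,47,10);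
     (0,51,113,74); (0,13,100,119); (0,115,43,45); (0,12,50,102); (0,54,74,79); (0,64,6,18); (0,48,93,32);
     (0,72,46,29); (0,7,91,98); (0,118,89,83); (0,122,52,72); (0,125,107,128); (0,105,2,65)]);
  ([:: (5,97,93); (68,43,114); (86,136,89); (102,31,49); (104,83,58); (105,88,65); (82,95,50); (44,2,28);
     (87,61,7); (18,55,112); (109,139,92); (99,81,13); (101,131,46); (119,98,39); (76,80,6);
     (141,142,113); (22,126,124); (62,56,107); (66,51,57); (71,110,73); (63,117,125); (106,75,91)],
   [:: (0,22,131,33); (0,78,130,123); (0,68,3,66); (0,67,1,29); (0,23,34,54); (0,77,33,67); (0,10,115,140);
     (0,106,5,91); (0,83,8,139); (0,139,82,122); (0,34,135,105); (0,109,116,117); (0,125,32,141);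
     (0,11,49,100); (0,88,81,62); (0,113,86,37); (0,83,103,42); (0,27,49,101); (0,63,44,138);
     (0,53,33,112); (0,14,55,135); (0,134,69,87)]);
  ([:: (127,11,86); (51,17,28); (22,123,60); (83,125,98); (37,133,105); (148,75,93); (59,116,76);
     (150,109,16); (48,3,85); (131,147,80); (43,21,139); (36,145,142); (14,62,111); (41,25,42);
     (146,35,56); (132,30,84); (96,29,82); (10,74,135); (155,1,19); (90,118,149); (124,151,87);
     (141,112,32); (128,44,23); (136,144,102)],
   [:: (0,62,56,151); (0,121,150,35); (0,44,14,36); (0,71,83,38); (0,10,147,3); (0,147,112,40);
     (0,24,70,101); (0,131,33,146); (0,149,8,135); (0,1,75,98); (0,149,3,57); (0,49,79,132);
     (0,19,69,129); (0,84,80,155); (0,113,77,94); (0,113,145,76); (0,62,133,11); (0,25,20,16);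
     (0,99,152,124); (0,46,144,44); (0,68,154,88); (0,33,120,126); (0,32,56,138); (0,95,90,48)]);
  ([:: (120,46,57); (88,10,37); (55,38,71); (128,108,138); (15,102,53); (101,145,7); (92,152,115);
     (134,153,87); (148,127,48); (150,123,143); (26,162,23); (16,25,75); (133,12,90); (65,27,144);
     (124,165,89); (151,58,32); (21,9,2); (131,147,85); (13,30,74); (19,106,45); (95,160,166);
     (167,163,72); (73,119,104); (146,136,33); (51,113,118); (161,164,41)],
   [:: (0,116,80,61); (0,80,13,130); (0,45,99,37); (0,104,96,29); (0,22,108,45); (0,82,93,57);
     (0,156,134,31); (0,25,24,119); (0,41,50,128); (0,110,18,164); (0,164,35,104); (0,144,71,76);
     (0,58,143,85); (0,162,125,10); (0,166,55,151); (0,115,63,24); (0,2,139,157); (0,104,13,134);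
     (0,147,36,156); (0,18,23,165); (0,167,53,88); (0,72,33,1); (0,40,109,7); (0,48,8,2); (0,83,68,127);
     (0,66,32,148)]);
  ([:: (10,119,142); (167,67,168); (102,9,111); (72,114,34); (141,2,14); (176,103,17); (158,22,163);
     (131,171,79); (53,159,110); (98,55,49); (84,170,46); (175,66,133); (76,63,36); (134,91,18);
     (42,172,109); (87,128,116); (3,152,147); (16,88,71); (118,149,83); (130,148,97); (74,94,138);
     (23,56,37); (6,101,25); (151,47,140); (122,144,27); (155,64,129); (160,33,5); (31,35,179)],
   [:: (0,133,3,97); (0,20,146,4); (0,103,56,14); (0,8,89,177); (0,59,157,35); (0,98,152,37); (0,83,18,139);
     (0,167,11,140); (0,68,146,74); (0,119,111,93); (0,112,170,66); (0,10,58,49); (0,22,143,20);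
     (0,103,154,110); (0,29,84,157); (0,166,96,64); (0,177,153,98); (0,110,176,163); (0,123,61,28);
     (0,62,145,179); (0,163,179,158); (0,148,79,67); (0,134,159,109); (0,6,52,132); (0,2,143,10);
     (0,7,99,118); (0,106,178,149); (0,171,7,103)]);
  ([:: (119,6,36); (51,185,139); (59,33,103); (115,162,27); (76,109,175); (169,60,40); (142,130,180);
     (94,1,170); (14,21,63); (81,151,166); (25,158,15); (61,8,17); (75,148,72); (108,37,126); (2,28,183);
     (122,118,41); (31,125,161); (163,152,57); (11,100,71); (184,106,38); (20,189,135); (95,150,78);
     (58,149,178); (90,181,143); (99,140,45); (173,114,83); (138,188,24); (86,105,146); (35,165,187);
     (68,101,49)],
   [:: (0,125,127,115); (0,174,68,79); (0,67,10,133); (0,31,157,156); (0,51,12,152); (0,22,15,39);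
     (0,98,17,184); (0,149,147,33); (0,113,134,60); (0,167,191,146); (0,1,85,51); (0,74,82,100);
     (0,127,27,170); (0,136,140,105); (0,165,129,57); (0,14,178,148); (0,43,117,188); (0,147,42,37);
     (0,105,145,15); (0,136,5,61); (0,110,179,165); (0,24,37,122); (0,121,172,83); (0,92,117,29);
     (0,186,131,173); (0,171,162,169); (0,69,35,41); (0,108,102,111); (0,184,187,119); (0,158,39,138)]);
  ([:: (202,1,192); (156,5,142); (203,149,133); (147,141,126); (4,168,43); (99,95,41); (173,62,26);
     (58,127,80); (116,200,111); (117,165,93); (89,175,120); (162,19,174); (49,158,112); (185,148,55);
     (167,84,172); (53,135,64); (20,27,123); (188,139,12); (130,171,48); (190,125,178); (177,3,44);
     (104,152,159); (97,189,124); (7,74,138); (140,180,42); (110,132,118); (137,59,193); (184,92,13);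
     (196,134,108); (113,81,52); (181,163,179); (96,131,67)],
   [:: (0,31,73,132); (0,15,109,167); (0,97,120,14); (0,26,47,185); (0,83,59,67); (0,106,97,108);
     (0,196,20,91); (0,162,165,174); (0,135,185,92); (0,152,141,198); (0,23,202,13); (0,36,32,186);
     (0,72,171,127); (0,100,91,123); (0,145,46,107); (0,144,124,20); (0,118,174,79); (0,89,13,164);
     (0,203,77,141); (0,152,58,87); (0,117,177,144); (0,74,154,70); (0,123,198,76); (0,159,114,90);
     (0,166,104,130); (0,117,161,203); (0,169,194,21); (0,167,66,94); (0,185,57,22); (0,38,113,116);
     (0,161,160,5); (0,90,186,179)]);
  ([:: (208,199,43); (133,73,166); (128,75,184); (111,83,69); (80,86,49); (124,5,6); (34,161,37);
     (196,135,163); (202,24,138); (173,92,193); (29,39,103); (63,107,149); (28,120,67); (9,32,78);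
     (182,1,192); (141,89,207); (152,121,51); (57,95,106); (201,210,56); (59,47,71); (143,64,61);
     (158,52,115); (4,15,174); (98,154,96); (82,105,60); (87,119,176); (148,2,19); (122,170,79);
     (23,48,212); (153,116,10); (130,42,21); (26,31,81); (38,97,77); (70,125,209)],
   [:: (0,41,48,9); (0,122,138,115); (0,136,119,42); (0,84,133,105); (0,133,155,67); (0,100,65,57);
     (0,4,201,56); (0,186,111,171); (0,215,122,25); (0,41,153,37); (0,91,171,204); (0,95,65,130);
     (0,187,29,91); (0,139,166,185); (0,34,120,93); (0,113,14,118); (0,82,184,38); (0,140,24,85);
     (0,149,157,99); (0,141,149,17); (0,148,154,107); (0,2,87,165); (0,190,203,127); (0,142,176,182);
     (0,197,128,148); (0,21,169,22); (0,7,78,81); (0,15,150,13); (0,176,73,187); (0,4,169,87);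
     (0,117,5,141); (0,172,96,202); (0,200,79,152); (0,131,26,10)]);
  ([:: (107,167,80); (48,15,14); (105,37,23); (17,63,42); (199,126,223); (134,11,195); (10,135,117);
     (62,33,184); (79,45,77); (73,102,161); (88,170,25); (22,211,83); (172,146,149); (182,75,130);
     (78,87,110); (1,52,188); (84,18,155); (165,150,141); (116,122,169); (67,111,196); (180,138,50);
     (143,212,34); (200,157,142); (140,118,183); (113,106,93); (9,54,96); (91,217,214); (226,163,174);
     (127,153,186); (185,203,101); (120,218,7); (119,40,213); (90,179,94); (31,144,222); (158,46,178);
     (175,92,173)],
   [:: (0,74,182,142); (0,62,14,72); (0,117,31,4); (0,211,93,220); (0,54,155,124); (0,99,188,144);
     (0,159,84,212); (0,96,200,6); (0,21,70,150); (0,56,66,91); (0,67,223,28); (0,148,222,46);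
     (0,13,8,119); (0,92,170,63); (0,39,8,89); (0,180,192,1); (0,60,166,214); (0,142,93,213);
     (0,157,4,136); (0,218,137,7); (0,227,109,173); (0,97,221,36); (0,164,191,215); (0,183,67,123);
     (0,175,203,22); (0,193,68,223); (0,111,70,93); (0,16,193,110); (0,216,151,131); (0,172,188,26);
     (0,30,80,196); (0,206,134,65); (0,90,120,79); (0,64,192,67); (0,54,101,42); (0,90,79,2)]);
  ([:: (156,202,44); (162,236,174); (215,121,31); (6,203,189); (98,9,237); (196,154,52); (50,207,103);
     (43,81,11); (51,75,77); (61,167,178); (212,205,219); (192,74,63); (79,94,147); (124,25,90);
     (233,217,48); (13,159,64); (29,155,67); (209,206,224); (230,23,71); (157,73,15); (186,122,59);
     (105,41,14); (127,173,49); (78,208,239); (118,148,17); (123,24,213); (68,32,165); (226,232,130);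
     (231,38,136); (190,125,8); (55,109,228); (114,33,57); (56,222,101); (84,150,21); (227,65,26);
     (12,115,22); (18,91,62); (216,19,46)],
   [:: (0,21,125,19); (0,204,195,231); (0,113,148,135); (0,224,26,30); (0,168,227,199); (0,210,107,99);
     (0,77,76,191); (0,156,179,48); (0,155,190,138); (0,25,122,195); (0,5,73,127); (0,87,8,171);
     (0,231,154,95); (0,18,106,74); (0,154,230,133); (0,148,135,50); (0,23,112,29); (0,22,115,12);
     (0,174,155,117); (0,196,188,235); (0,28,50,203); (0,25,135,67); (0,208,126,197); (0,59,108,75);
     (0,31,72,216); (0,28,185,119); (0,69,52,18); (0,192,131,15); (0,37,108,101); (0,219,223,161);
     (0,165,116,226); (0,56,221,128); (0,173,2,25); (0,207,153,154); (0,91,29,3); (0,6,199,164);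
     (0,203,237,159); (0,235,236,146)]);
  ([:: (50,200,215); (120,149,56); (178,15,4); (240,144,230); (13,183,239); (12,116,220); (91,98,31);
     (191,29,185); (45,145,85); (20,58,225); (44,7,39); (96,16,218); (119,46,34); (123,192,28);
     (206,152,198); (203,33,10); (37,153,135); (64,244,40); (121,137,202); (226,38,43); (17,62,93);
     (199,174,196); (71,180,25); (117,204,216); (75,134,111); (32,67,51); (103,36,238); (1,109,167);
     (55,208,86); (251,236,148); (61,97,221); (122,161,129); (132,108,102); (214,87,14); (106,209,107);
     (179,24,2); (30,5,227); (81,241,194); (124,173,49); (195,60,205)],
   [:: (0,20,78,137); (0,180,26,102); (0,133,144,30); (0,161,18,79); (0,51,49,226); (0,232,71,23);
     (0,239,196,15); (0,79,118,89); (0,219,44,215); (0,145,62,156); (0,14,57,38); (0,218,191,123);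
     (0,224,131,97); (0,118,146,201); (0,110,225,107); (0,3,74,91); (0,219,125,192); (0,218,95,165);
     (0,204,89,195); (0,114,243,41); (0,77,142,167); (0,178,233,35); (0,201,17,18); (0,132,133,2);
     (0,250,184,44); (0,235,53,39); (0,45,80,144); (0,141,101,221); (0,146,8,13); (0,113,37,178);
     (0,62,132,154); (0,79,38,32); (0,14,200,72); (0,152,111,66); (0,4,199,40); (0,4,116,16);
     (0,13,171,20); (0,131,140,244); (0,54,223,190); (0,90,191,142)]);
  ([:: (125,21,167); (256,181,213); (152,43,169); (50,52,193); (148,249,172); (78,146,8); (158,164,133);
     (54,39,214); (27,156,87); (215,236,25); (136,263,62); (135,250,76); (248,46,151); (235,77,199);
     (98,231,95); (150,225,17); (222,203,238); (89,53,173); (5,239,114); (108,12,229); (42,129,96);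
     (69,63,142); (100,130,191); (80,165,13); (134,253,216); (179,162,234); (45,11,34); (226,147,120);
     (138,197,68); (31,205,202); (188,245,206); (207,115,233); (57,58,105); (170,160,180); (7,141,36);
     (128,161,211); (127,224,112); (218,23,258); (187,255,254); (217,251,64); (241,223,243); (60,183,72)],
   [:: (0,72,191,192); (0,5,108,46); (0,149,25,187); (0,214,166,130); (0,82,232,241); (0,127,227,2);
     (0,86,243,11); (0,64,206,116); (0,35,43,15); (0,5,156,196); (0,102,8,114); (0,161,202,261);
     (0,116,144,229); (0,250,27,142); (0,81,177,210); (0,130,186,200); (0,38,260,65); (0,166,180,25);
     (0,188,16,42); (0,116,240,19); (0,46,255,207); (0,233,150,24); (0,219,210,83); (0,71,171,92);
     (0,53,236,186); (0,38,251,45); (0,260,200,171); (0,169,157,71); (0,26,7,234); (0,57,170,117);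
     (0,7,58,177); (0,212,163,230); (0,39,85,254); (0,49,89,140); (0,86,203,99); (0,80,219,143);
     (0,102,165,182); (0,71,136,183); (0,241,165,8); (0,253,173,5); (0,186,199,260); (0,147,95,258)]);
  ([:: (274,38,255); (218,109,122); (240,72,116); (180,199,14); (73,3,196); (172,197,272); (245,71,100);
     (18,261,76); (225,124,189); (268,256,155); (11,5,98); (30,137,217); (194,53,44); (67,160,24);
     (133,95,265); (177,65,120); (150,21,201); (28,106,131); (200,242,112); (84,229,195); (68,94,128);
     (198,228,227); (93,252,49); (157,50,105); (235,20,249); (154,77,139); (175,216,174); (33,248,83);
     (119,54,263); (113,40,163); (129,2,66); (145,264,29); (35,82,52); (185,170,146); (186,26,135);
     (147,226,213); (153,55,64); (237,223,234); (179,181,103); (86,212,169); (165,259,10); (132,142,246);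
     (239,208,219); (45,6,13)],
   [:: (0,137,135,81); (0,182,231,97); (0,181,163,170); (0,16,255,93); (0,254,36,91); (0,21,266,263);
     (0,118,20,116); (0,49,269,245); (0,270,140,141); (0,206,82,225); (0,179,155,215); (0,106,249,18);
     (0,236,159,124); (0,179,54,209); (0,99,271,132); (0,191,209,125); (0,223,95,153); (0,260,60,149);
     (0,222,45,140); (0,35,87,14); (0,166,102,271); (0,241,238,63); (0,156,128,38); (0,122,196,268);
     (0,105,195,173); (0,57,194,166); (0,239,243,50); (0,186,68,9); (0,59,143,260); (0,48,202,52);
     (0,201,272,228); (0,204,142,236); (0,204,84,229); (0,134,112,212); (0,205,271,37); (0,191,223,197);
     (0,119,268,57); (0,81,228,71); (0,190,173,202); (0,162,190,86); (0,88,151,49); (0,105,79,122);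
     (0,264,208,223); (0,268,100,120)]);
  ([:: (102,230,121); (92,160,2); (218,196,237); (165,111,191); (189,241,263); (10,33,206); (286,202,156);
     (122,44,128); (277,5,46); (42,100,181); (79,83,164); (89,199,171); (13,30,148); (207,205,114);
     (139,287,109); (163,69,151); (211,26,49); (91,106,112); (135,117,152); (169,282,242); (29,115,11);
     (271,226,221); (32,130,172); (40,39,204); (247,147,162); (75,208,41); (17,252,150); (145,243,268);
     (275,228,158); (68,76,141); (178,9,198); (110,51,245); (43,197,239); (262,31,215); (81,70,280);
     (210,78,260); (238,36,126); (134,251,88); (15,35,269); (273,281,167); (231,57,140); (217,182,22);
     (50,200,267); (234,113,229); (59,209,248); (132,80,105)],
   [:: (0,102,177,170); (0,164,154,132); (0,10,191,160); (0,32,277,9); (0,166,229,49); (0,141,33,145);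
     (0,7,152,82); (0,1,259,110); (0,183,226,238); (0,27,31,221); (0,49,226,280); (0,131,162,126);
     (0,276,255,71); (0,7,221,10); (0,170,275,223); (0,274,55,76); (0,200,64,1); (0,125,97,84);
     (0,259,83,286); (0,70,149,270); (0,151,95,258); (0,244,143,277); (0,228,9,263); (0,76,227,127);
     (0,227,132,58); (0,230,64,101); (0,237,9,164); (0,63,26,141); (0,209,285,56); (0,172,252,269);
     (0,36,113,158); (0,49,100,246); (0,146,233,262); (0,223,179,14); (0,77,32,183); (0,115,274,208);
     (0,272,201,87); (0,108,161,177); (0,250,89,43); (0,38,169,282); (0,3,40,102); (0,181,142,273);
     (0,56,185,249); (0,66,68,28); (0,66,213,152); (0,275,187,47)]);
  ([:: (185,226,133); (19,197,161); (163,181,171); (248,296,99); (97,46,241); (244,92,55); (102,179,184);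
     (87,149,290); (17,156,282); (40,105,42); (265,41,182); (270,27,269); (174,288,207); (211,106,210);
     (141,215,189); (83,118,12); (158,230,73); (48,15,178); (287,170,155); (176,69,278); (254,108,145);
     (135,203,23); (88,204,236); (272,264,36); (117,72,56); (43,130,159); (253,116,147); (82,3,212);
     (224,110,243); (292,44,139); (245,18,231); (123,96,85); (77,276,121); (164,33,79); (30,221,274);
     (107,279,240); (111,234,214); (148,109,1); (58,38,4); (22,277,51); (209,7,187); (251,52,16);
     (89,294,78); (68,63,45); (263,131,217); (136,152,199); (160,143,220); (134,262,66)],
   [:: (0,92,89,254); (0,127,174,229); (0,129,51,60); (0,90,203,293); (0,79,66,36); (0,286,121,234);
     (0,66,160,115); (0,134,96,207); (0,220,233,67); (0,224,273,83); (0,241,60,146); (0,69,251,292);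
     (0,31,158,78); (0,164,288,287); (0,214,71,51); (0,140,274,118); (0,84,54,89); (0,296,58,170);
     (0,69,281,101); (0,118,22,258); (0,7,283,31); (0,247,70,17); (0,115,138,16); (0,40,279,192);
     (0,10,129,33); (0,211,268,107); (0,70,113,109); (0,42,83,215); (0,156,236,262); (0,110,108,171);
     (0,297,293,11); (0,165,44,202); (0,198,59,183); (0,183,189,155); (0,151,244,2); (0,99,78,105);
     (0,145,218,164); (0,188,154,228); (0,210,9,128); (0,185,176,279); (0,88,169,12); (0,110,202,81);
     (0,257,285,169); (0,40,28,84); (0,162,107,221); (0,294,270,62); (0,245,178,235); (0,136,94,3)]);
  ([:: (237,54,109); (101,131,18); (305,44,82); (270,186,232); (289,92,134); (158,110,166); (181,89,262);
     (276,259,236); (145,152,215); (170,269,150); (40,12,19); (98,275,123); (280,165,309); (94,311,212);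
     (21,105,65); (68,53,284); (83,97,282); (20,277,172); (171,235,206); (28,38,169); (125,247,36);
     (216,66,55); (64,243,111); (180,73,231); (213,58,225); (251,32,288); (23,255,3); (187,8,296);
     (161,162,45); (304,246,240); (35,228,204); (157,307,118); (242,27,70); (303,96,294); (39,160,217);
     (107,141,198); (144,37,22); (190,249,163); (108,47,33); (11,127,102); (256,233,122); (241,46,67);
     (41,227,135); (298,117,205); (199,271,62); (116,230,302); (299,112,129); (17,154,185); (295,137,63);
     (51,88,136)],
   [:: (0,210,308,214); (0,191,252,33); (0,71,44,85); (0,106,279,263); (0,280,293,262); (0,230,243,185);
     (0,201,217,192); (0,98,307,265); (0,216,194,189); (0,237,170,238); (0,188,135,64); (0,147,233,13);
     (0,164,258,116); (0,176,12,191); (0,204,266,95); (0,249,34,160); (0,241,82,172); (0,3,50,165);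
     (0,212,65,19); (0,16,192,305); (0,128,138,56); (0,244,112,83); (0,239,129,309); (0,83,125,190);
     (0,32,279,21); (0,276,74,278); (0,259,35,237); (0,253,245,169); (0,269,271,166); (0,239,163,277);
     (0,5,171,231); (0,243,31,280); (0,54,242,131); (0,210,87,246); (0,11,246,102); (0,222,284,135);
     (0,90,22,39); (0,18,294,6); (0,306,267,239); (0,166,309,136); (0,127,77,117); (0,76,282,164);
     (0,204,203,304); (0,172,85,129); (0,49,58,233); (0,263,267,206); (0,41,200,138); (0,163,2,259);
     (0,192,211,112); (0,145,66,125)]);
  ([:: (195,226,30); (312,37,19); (146,246,287); (134,42,136); (250,206,73); (180,259,79); (288,284,212);
     (200,165,48); (232,301,106); (55,215,320); (229,262,104); (96,58,251); (154,322,10); (85,257,175);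
     (211,32,260); (304,148,290); (147,159,167); (83,28,130); (61,153,302); (185,281,2); (161,273,231);
     (22,35,291); (295,51,110); (34,41,157); (21,59,261); (39,244,116); (305,207,222); (225,121,7);
     (307,254,209); (265,179,114); (187,168,124); (72,8,14); (269,249,115); (264,11,186); (237,90,120);
     (238,93,123); (152,311,144); (68,228,279); (94,263,191); (77,36,275); (16,62,166); (205,137,91);
     (174,240,74); (248,171,317); (318,105,15); (208,227,141); (193,1,219); (182,40,293); (214,188,289);
     (138,271,132); (274,218,242); (151,71,280)],
   [:: (0,136,43,104); (0,290,40,65); (0,272,132,82); (0,151,58,98); (0,10,321,11); (0,321,11,91);
     (0,32,61,147); (0,290,53,73); (0,87,62,273); (0,9,163,250); (0,181,302,8); (0,306,153,280);
     (0,107,82,88); (0,39,313,35); (0,308,309,169); (0,146,109,239); (0,317,17,181); (0,227,23,90);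
     (0,272,273,301); (0,138,28,131); (0,95,21,201); (0,10,150,79); (0,5,123,126); (0,282,60,272);
     (0,197,79,235); (0,194,78,22); (0,291,287,95); (0,219,134,176); (0,262,214,92); (0,124,67,266);
     (0,188,66,183); (0,99,70,36); (0,148,57,315); (0,264,28,15); (0,89,322,208); (0,200,307,161);
     (0,249,63,96); (0,199,221,276); (0,274,39,150); (0,94,137,37); (0,40,35,254); (0,148,112,277);
     (0,103,119,252); (0,225,64,2); (0,61,137,120); (0,48,259,308); (0,251,121,45); (0,215,88,246);
     (0,23,204,306); (0,47,56,68); (0,240,167,264); (0,229,36,145)])].

Lemma cyclic_frames_check :
  all (fun t => let OI := nth ([::], [::]) cyclic_frames (t - 4) in
         cyclic_check t OI.1 OI.2) (iota 4 24).
Proof. by vm_compute. Qed.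

Lemma frame_small_order t : 4 <= t < 28 -> frame (iota 0 t).
Proof.
move=> t_range; have /allP/(_ t) := cyclic_frames_check.
rewrite mem_iota => /(_ t_range); apply: frame_cyclic; lia.
Qed.

(** * Filling the groups with a nested design on 12 points *)

(* The first 24 triples form six of the eleven parallel classes of a resolvable
   (12,3,2)-BIBD on Z_11 and infinity = 11; each class is assigned to a new point.
   The remaining five classes have centers inside X, found by backtracking. *)
Definition design12 : seq (nat * nat * nat * nat) := [::
     (5,6,9,12); (2,4,7,12); (1,3,8,12); (0,10,11,12); (6,7,10,13); (3,5,8,13); (2,4,9,13); (1,0,11,13);
     (7,8,0,14); (4,6,9,14); (3,5,10,14); (2,1,11,14); (10,0,3,15); (7,9,1,15); (6,8,2,15); (5,4,11,15);
     (1,2,5,16); (9,0,3,16); (8,10,4,16); (7,6,11,16); (2,3,6,17); (10,1,4,17); (9,0,5,17); (8,7,11,17);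
     (9,10,2,0); (6,8,0,1); (5,7,1,3); (4,3,11,9); (3,4,7,0); (0,2,5,6); (10,1,6,4); (9,8,11,5);
     (4,5,8,7); (1,3,6,11); (0,2,7,11); (10,9,11,8); (8,9,1,2); (5,7,10,2); (4,6,0,8); (3,2,11,4);
     (0,1,4,5); (8,10,2,3); (7,9,3,6); (6,5,11,10)].

Definition complete_rel w (x y : nat) : nat := [&& x < w, y < w & x != y].

Lemma nested_design12 : nested (fun x => x < 12) (complete_rel 18) design12.
Proof.
(* [nested] ranges over all naturals; pairs with an entry at least 18 never occur, which leaves a
   finite computation. *)
have bnd (f : nat * nat * nat * nat -> seq (nat * nat)) x y :
    all (fun ab => (ab.1 < 18) && (ab.2 < 18)) (flatten (map f design12)) ->
    ~~ ((x < 18) && (y < 18)) -> count_mem (x, y) (flatten (map f design12)) = 0.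
  move=> /allP lt18 nxy; apply/eqP; rewrite -leqn0 leqNgt -has_count has_pred1.
  by apply: contra nxy => /lt18.
move=> x y; case: (boolP ((x < 18) && (y < 18))) => [/andP[hx hy]|nxy].
  have chk : all (fun x => all (fun y =>
      (count_mem (x, y) (flatten (map (@tri _) design12)) ==
        2 * (complete_rel 18 x y * ((x < 12) && (y < 12)))) &&
      (count_mem (x, y) (flatten (map (@star _) design12)) <= complete_rel 18 x y))
      (iota 0 18)) (iota 0 18) by vm_compute.
  have /allP/(_ x) := chk; rewrite mem_iota => /(_ hx)/allP/(_ y).
  by rewrite mem_iota => /(_ hy)/andP[/eqP].
rewrite !bnd //; split=> //; rewrite /complete_rel andbA (negbTE nxy) /=.
by rewrite mul0n.
Qed.

(** Pairs across groups come from the frame, pairs inside group i from a copy of [design12] on that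
    group; together these are all pairs. *)
Lemma nestable_complete t : 0 < t -> frame (iota 0 t) ->
  nestable (fun z => z < 12 * t) (complete_rel (18 * t)).
Proof.
move=> t_gt0 frame_t.
pose E (i : nat) (x y : nat * nat) : nat :=
  ((x.1 == i) && (y.1 == i)) * complete_rel 18 x.2 y.2.
have nE i : i \in iota 0 t -> nestable (fun x => x.2 < 12) (E i).
  move=> _; have nst : nestable (fun x => x < 12) (complete_rel 18).
    by exists design12; apply: nested_design12.
  apply: (nestable_map (f := fun l => (i, l)) (g := snd)
     (D := xpredT) (D' := fun x => x.1 == i) _ _ _ _ nst) => //=.
  - by move=> [u l] /= /eqP->.
have nst := nestableD frame_t (nestable_sum nE).
(* Numbering the points level by level makes X, the levels below 12, the initial segment below
   12t. *)
apply: (nestable_map (f := fun x => x.2 * t + x.1) (g := fun z => (z %% t, z %/ t))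
   (D := fun x => (x.1 < t) && (x.2 < 18)) (D' := fun z => z < 18 * t) _ _ _ _ nst).
- move=> x y; rewrite /frame_rel !mem_iota /=.
  case: (boolP [&& _, _, _, _ & _]) => [/and5P[-> -> _ -> ->] //|_].
  rewrite add0n lt0n sum_nat_seq_neq0 => /hasP[i]; rewrite mem_iota => /= hi.
  rewrite /E muln_eq0 !eqb0 negb_or !negbK => /andP[/andP[/eqP-> /eqP->]].
  by rewrite hi => /and3P[-> ->].
- move=> [u l] /= /andP[hu hl]; rewrite modnMDl modn_small // divnMDl // divn_small // addn0.
  by split=> //; nia.
- move=> z hz; rewrite /= ltn_pmod // ltn_divLR // -divn_eq; split=> //.
move=> z w; rewrite /frame_rel /complete_rel !mem_iota /= !ltn_pmod //.
case: (boolP (z < _)) => hz //=; case: (boolP (w < _)) => hw //=.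
rewrite !ltn_divLR // hz hw mul1n /= andbT.
have sumE : \sum_(i <- iota 0 t) E i (z %% t, z %/ t) (w %% t, w %/ t) =
    (z %% t == w %% t) && (z %/ t != w %/ t).
  rewrite (bigD1_seq (z %% t)) ?mem_iota ?iota_uniq ?ltn_pmod //= big1 => [|i].
    by rewrite /E /complete_rel /= !ltn_divLR // hz hw !eqxx /= addn0 mulnb eq_sym.
  by rewrite /E /= eq_sym => /negbTE->.
rewrite sumE {1}(divn_eq z t) {1}(divn_eq w t).
have [eqm|nem] := eqVneq (z %% t) (w %% t).
  by rewrite eqm eqn_add2r eqn_pmul2r.
rewrite addn0; congr (nat_of_bool _).
by apply: contraNneq nem => /(congr1 (modn^~ t)); rewrite !modnMDl !modn_mod => ->.
Qed.

(** * From counted families to strong nestings of block designs *)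

Section StrongNesting.
Variables (v w : nat) (F : seq (nat * nat * nat * nat)).
Hypothesis le_vw : v <= w.+1.
Hypothesis nF : nested (fun z => z < v) (complete_rel w.+1) F.

(** A pair that occurs has a positive count, so neither [complete_rel] nor the indicator of X
    vanishes on it. *)
Lemma tri_bound q ab : q \in F -> ab \in tri q ->
  [/\ ab.1 < v, ab.2 < v & ab.1 != ab.2].
Proof.
case: ab => a b qF qab; have [+ _] := nF a b.
have: 0 < count_mem (a, b) (flatten (map (@tri _) F)).
  by rewrite -has_count has_pred1; apply/flattenP; exists (tri q); rewrite ?map_f.
move=> + eqc; rewrite eqc /complete_rel.
by case: (a < v); case: (b < v); case: (a != b) => //=; rewrite ?andbF ?muln0.
Qed.

Lemma star_bound q ab : q \in F -> ab \in star q -> ab.2 < w.+1 /\ ab.1 != ab.2.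
Proof.
case: ab => a b qF qab; have [_] := nF a b.
have: 0 < count_mem (a, b) (flatten (map (@star _) F)).
  by rewrite -has_count has_pred1; apply/flattenP; exists (star q); rewrite ?map_f.
move=> /leq_trans lt /lt; rewrite /complete_rel.
by case: (b < w.+1); case: (a != b) => //=; rewrite ?andbF.
Qed.

Definition block_of (q : nat * nat * nat * nat) : {set 'I_v} :=
  let: (a, b, c, _) := q in [set i | val i \in [:: a; b; c]].

Lemma card_block_of q : q \in F -> #|block_of q| = 3.
Proof.
case: q => [[[a b] c] p] qF.
have [|ha hb nab] := @tri_bound _ (a, b) qF; first by rewrite !inE eqxx.
have [|_ hc nac] := @tri_bound _ (a, c) qF; first by rewrite !inE eqxx !orbT.
have [|_ _ nbc] := @tri_bound _ (b, c) qF; first by rewrite !inE eqxx !orbT.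
rewrite /= in ha hb hc nab nac nbc.
have -> : block_of (a, b, c, p) = [set Ordinal ha; Ordinal hb; Ordinal hc].
  by apply/setP => i; rewrite !inE -!val_eqE /= orbA.
rewrite setUC cardsU1 cards2 !inE -!val_eqE /= nab.
by rewrite ![c == _]eq_sym (negbTE nac) (negbTE nbc).
Qed.

(** The entries of a triple are distinct, so an ordered pair of distinct points occurs in [tri] once
    if both lie in the block and not at all otherwise. *)
Lemma bibd_block_of : is_bibd 3 2 (map block_of F).
Proof.
split=> [A /mapP[q qF ->]|x y nxy]; first exact: card_block_of.
have [] := nF x y; rewrite !ltn_ord /complete_rel nxy.
rewrite !(leq_trans (ltn_ord _) le_vw) /= !muln1 => + _; move=> <-.
rewrite count_map -sum1_count big_mkcond count_flatten_big.
apply: eq_big_seq => -[[[a b] c] p] qF.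
have [|_ _ nab] := @tri_bound _ (a, b) qF; first by rewrite !inE eqxx.
have [|_ _ nac] := @tri_bound _ (a, c) qF; first by rewrite !inE eqxx !orbT.
have [|_ _ nbc] := @tri_bound _ (b, c) qF; first by rewrite !inE eqxx !orbT.
rewrite /= in nab nac nbc; rewrite -val_eqE /= in nxy.
rewrite /block_of /= !inE !xpair_eqE.
move: (val x) (val y) nxy => {}x {}y nxy.
rewrite ![a == _]eq_sym ![b == _]eq_sym ![c == _]eq_sym.
(* No point equals two entries and no entry equals both points; under these exclusions the claim is
   a truth table in six equalities. *)
have excl (u u' z : nat) : u != u' -> ~~ ((z == u) && (z == u')).
  by apply: contraNN => /andP[/eqP<- /eqP<-].
have excl' u : ~~ ((x == u) && (y == u)).
  by apply: contra nxy => /andP[/eqP-> /eqP->].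
move: (excl _ _ x nab) (excl _ _ x nac) (excl _ _ x nbc) (excl _ _ y nab)
  (excl _ _ y nac) (excl _ _ y nbc) (excl' a) (excl' b) (excl' c).
by do 6!case: (_ == _).
Qed.

(** The successor makes the ordinal type inhabited for [inord]; [star_bound] guarantees that the
    default is never taken. *)
Definition center (q : nat * nat * nat * nat) : 'I_w.+1 := inord q.2.

(** For i < j, a common pair would be counted once among the first j stars and once more in star j,
    against multiplicity at most 1. *)
Lemma star_unique i j z : i < size F -> j < size F ->
    z \in star (nth (0, 0, 0, 0) F i) -> z \in star (nth (0, 0, 0, 0) F j) -> i = j.
Proof.
wlog lt_ij : i j / i < j => [IH|] hi hj zi zj.
  by case: (ltngtP i j) => // lt; [|apply/esym]; apply: IH.
have cnt k : k < size F -> z \in star (nth (0, 0, 0, 0) F k) ->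
    0 < count_mem z (star (nth (0, 0, 0, 0) F k)).
  by move=> _ zk; rewrite -has_count has_pred1.
have : count_mem z (flatten (map (@star _) F)) <= 1.
  case: z {zi zj cnt} => a b; have [_ /leq_trans] := nF a b; apply.
  by rewrite /complete_rel; case: [&& _, _ & _].
rewrite -{1}(cat_take_drop j F) map_cat flatten_cat count_cat.
have := cnt _ hj zj; rewrite (drop_nth (0, 0, 0, 0)) //= count_cat.
have : 0 < count_mem z (flatten (map (@star _) (take j F))).
  rewrite -has_count has_pred1; apply/flattenP; exists (star (nth (0, 0, 0, 0) F i)) => //.
  by apply: map_f; rewrite -(nth_take _ lt_ij) mem_nth // size_take hj.
move=> h1 h2; rewrite addnA => /(leq_trans (leq_addr _ _)).
by move/(leq_trans (leq_add h1 h2)).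
Qed.

Lemma has_strong_nesting_of_nested : has_strong_nesting v 3 2 w.+1.
Proof.
pose B := map block_of F; pose q0 := (0, 0, 0, 0).
have sizeB : size B = size F by rewrite size_map.
pose quad (i : 'I_(size B)) := nth q0 F i.
have quadF i : quad i \in F by rewrite mem_nth // -sizeB.
have blkE i : blk i = block_of (quad i).
  by rewrite /blk (tnth_nth (block_of q0)) (nth_map q0) // -sizeB.
have starE i (x : 'I_v) : x \in blk i ->
    ((val x, val (center (quad i))) \in star (quad i)) /\
    ((val (center (quad i)), val x) \in star (quad i)).
  rewrite blkE; have := quadF i; case: (quad i) => [[[a b] c] p] qF.
  have [|hp _] := @star_bound _ (a, p) qF; first by rewrite !inE eqxx.
  rewrite /block_of /center /= !inE inordK // !xpair_eqE !eqxx /= => h.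
  by case/or3P: h => /eqP->; rewrite !eqxx ?orbT.
exists B, (widen_ord le_vw), (fun i => center (quad i)).
split; first by move=> x y /(congr1 val) /= /val_inj.
split; first exact: bibd_block_of.
have notin i (x : 'I_v) : x \in blk i -> widen_ord le_vw x != center (quad i).
  by move=> /starE[/(star_bound (quadF i))[_]].
split=> [i|i j x y xi yj eqs].
  apply/imsetP => -[x xi eqx]; have := notin i x xi; by rewrite eqx eqxx.
have [sx1 sx2] := starE i x xi; have [sy1 sy2] := starE j y yj.
have hi : i < size F by rewrite -sizeB.
have hj : j < size F by rewrite -sizeB.
have eq_ij : i = j.
  have : widen_ord le_vw x \in [set widen_ord le_vw y; center (quad j)].
    by rewrite -eqs !inE eqxx.
  have : center (quad i) \in [set widen_ord le_vw y; center (quad j)].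
    by rewrite -eqs !inE eqxx orbT.
  (* The first and last cases identify a point with its own center. The middle two are the crossed
     and the direct matching; the crossed one uses the reversed pair in the star of [j]. *)
  rewrite !inE => /orP[] /eqP ec /orP[] /eqP ex.
  - by have := notin i x xi; rewrite ec ex eqxx.
  - apply: val_inj; apply: (star_unique hi hj sx1).
    by rewrite -[val x]/(val (widen_ord le_vw x)) ec ex.
  - apply: val_inj; apply: (star_unique hi hj sx1).
    by rewrite -[val x]/(val (widen_ord le_vw x)) ec ex.
  - by have := notin i x xi; rewrite ec ex eqxx.
split=> //; subst j.
have : widen_ord le_vw x \in [set widen_ord le_vw y; center (quad i)].
  by rewrite -eqs !inE eqxx.
by rewrite !inE (negbTE (notin i x xi)) orbF => /eqP /(congr1 val) /= /val_inj.
Qed.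

End StrongNesting.

(** * Lower bound by double counting, and conclusion *)

(** Count the pairs (y, A) with y other than x and both in A: each of the v - 1 points y gives 2,
    and each block through x gives 2. *)
Lemma bibd_degree v (B : seq {set 'I_v}) x :
  is_bibd 3 2 B -> count (fun A : {set 'I_v} => x \in A) B = v.-1.
Proof.
case=> card3 pair2; apply/eqP; rewrite -(eqn_pmul2r (isT : 0 < 2)); apply/eqP.
have <- : \sum_(y | y != x) count (fun A : {set 'I_v} => (x \in A) && (y \in A)) B = v.-1 * 2.
  rewrite (eq_bigr (fun _ => 2)) => [|y]; last by rewrite eq_sym => /pair2.
  by rewrite sum_nat_const cardC1 card_ord.
rewrite -sum1_count big_distrl big_mkcond /=.
under [RHS]eq_bigr do rewrite -sum1_count big_mkcond.
rewrite exchange_big; apply: eq_big_seq => A /card3 cA.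
case: (boolP (x \in A)) => [xA|_]; last by rewrite big1.
rewrite mul1n -big_mkcondr sum1dep_card.
transitivity #|A :\ x|; first by have := cardsD1 x A; rewrite xA cA => -[].
by apply: eq_card => y; rewrite !inE.
Qed.

(** The v (v - 1) incidences of points and blocks give 2 v (v - 1) distinct ordered pairs of unequal
    points meeting X, and the number of all such pairs is at most v (w - 1) + (w - v) v. *)
Lemma strong_nesting_bound v w : has_strong_nesting v 3 2 w -> 3 * v <= 2 * w + 1.
Proof.
case=> B [emb [phi [inj_emb [bibd [notin uniq_pair]]]]].
case: (posnP v) => [->//|v_gt0].
pose X := emb @: [set: 'I_v].
have cardX : #|X| = v by rewrite card_imset // cardsT card_ord.
have le_vw : v <= w by rewrite -cardX -[leqRHS]card_ord max_card.
pose U := [set ix : 'I_(size B) * 'I_v | ix.2 \in blk ix.1].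
have cardU : #|U| = v * v.-1.
  transitivity (\sum_(x : 'I_v) v.-1); last by rewrite sum_nat_const card_ord.
  rewrite -sum1_card (eq_bigl (fun ix => xpredT ix.2 && (ix.2 \in blk ix.1))) => [|ix];
    last by rewrite inE.
  rewrite -(pair_big_dep xpredT (fun i x => x \in blk i) (fun _ _ => 1)) /=.
  rewrite (exchange_big_dep xpredT) //=; apply: eq_bigr => x _.
  rewrite -(bibd_degree x bibd) -sum1_count (big_tnth _ _ B) /=.
  by [].
pose out (ix : 'I_(size B) * 'I_v) := (emb ix.2, phi ix.1).
pose inn (ix : 'I_(size B) * 'I_v) := (phi ix.1, emb ix.2).
pose W := [set yz : 'I_w * 'I_w | (yz.1 != yz.2) && ((yz.1 \in X) || (yz.2 \in X))].
have inj_out : {in U &, injective out}.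
  move=> [i x] [j y]; rewrite !inE /= => xi yj [ex ep].
  by have [-> ->] := uniq_pair i j x y xi yj (congr2 (fun a b => [set a; b]) ex ep).
have inj_inn : {in U &, injective inn}.
  by move=> u u' hu hu' [e1 e2]; apply: inj_out => //; rewrite /out e1 e2.
have neq ix : ix \in U -> emb ix.2 != phi ix.1.
  rewrite inE => xi; apply: contraNneq (notin ix.1) => <-; exact: imset_f.
(* An overlap would be an equality of crossed unordered pairs, forcing the same incidence and hence
   a point equal to its own center. *)
have disj : [disjoint out @: U & inn @: U].
  apply/pred0P => yz /=; apply: contraTF isT => /andP[/imsetP[[i x] hu ->] /imsetP[[j y] hu']].
  case=> ex ep; have := neq _ hu; move: hu hu'; rewrite !inE /= => xi yj.
  have [|eij exy] := uniq_pair i j x y xi yj; first by rewrite ex ep setUC.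
  by rewrite ex eij eqxx.
have subW : out @: U :|: inn @: U \subset W.
  have memX x : emb x \in X by apply: imset_f.
  apply/subsetP => yz; rewrite inE => /orP[] /imsetP[ix hu ->]; rewrite inE /= memX ?orbT andbT.
    exact: neq.
  by rewrite eq_sym neq.
(* First entries in X allow w - 1 second entries; the other w - v first entries require a second
   entry in X. *)
have cardW : #|W| <= v * w.-1 + (w - v) * v.
  rewrite -sum1_card (eq_bigl (fun yz : 'I_w * 'I_w => xpredT yz.1 &&
    ((yz.1 != yz.2) && ((yz.1 \in X) || (yz.2 \in X))))) => [|yz]; last by rewrite inE.
  rewrite -(pair_big_dep xpredT (fun y z : 'I_w => (y != z) && ((y \in X) || (z \in X)))
    (fun _ _ => 1)) /= (bigID (mem X)) /= leq_add //.
    rewrite -{1}cardX -sum_nat_const leq_sum // => y yX.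
    rewrite sum1dep_card (_ : [set _ | _] = [set~ y]) ?cardsC1 ?card_ord //.
    by apply/setP => z; rewrite !inE yX andbT eq_sym.
  have -> : w - v = #|~: X| by rewrite cardsCs setCK card_ord cardX.
  rewrite -sum_nat_const -cardX; under [leqRHS]eq_bigl do rewrite inE.
  rewrite leq_sum // => y /negbTE yX; rewrite sum1dep_card subset_leq_card //.
  by apply/subsetP => z; rewrite !inE yX => /andP[].
have := subset_leq_card subW.
rewrite cardsU (disjoint_setI0 disj) cards0 subn0 !card_in_imset // cardU.
(* Dividing by v leaves 2 (v - 1) <= (w - 1) + (w - v). *)
move=> /leq_trans/(_ cardW); rewrite [(w - v) * v]mulnC -!mulnDr leq_pmul2l //.
lia.
Qed.

Theorem theorem4p7 (t : nat) : 4 <= t ->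
  has_strong_nesting (12 * t) 3 2 (18 * t) /\
  (forall w, has_strong_nesting (12 * t) 3 2 w -> 18 * t <= w).
Proof.
(* By parity, 36t <= 2w + 1 already gives 18t <= w. *)
move=> t4; split=> [|w /strong_nesting_bound]; last by lia.
have frame_t : frame (iota 0 t).
  by apply: frame_iota frame_small_order _; rewrite !inE; lia.
have [F nF] := nestable_complete (ltnW (ltnW (ltnW t4))) frame_t.
have e18 : 18 * t = (18 * t).-1.+1 by lia.
rewrite e18 in nF *; apply: has_strong_nesting_of_nested nF; lia.
Qed.
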